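(* For $k\in\{1,\dots,N\}$ let $(H_k)$ denote the statement: for every $F\in\tilde{\mathcal F}^k$ and every atom $\mathcal E$ of $\mathfrak A_k$, the induced subgraph $F|_{\mathcal E}$ is a tree. If $(H_k)$ holds for every $k\in\{1,\dots,N-1\}$ satisfying the strict inequality $\phi^{k-1}-\phi^k>\phi^k-\phi^{k+1}$, then $(H_k)$ holds for all $k\in\{1,\dots,N\}$.
   Context: $V$ is a digraph with vertex set $\mathcal N$, $|\mathcal N|=N$, real arc weights $v_{ij}$, having at least one spanning tree. An (entering) forest is a digraph in which every vertex has at most one outgoing arc and there is no directed cycle; its weakly connected components are trees. $\mathcal F^k$ is the set of spanning forests of $V$ with exactly $k$ trees; $\Upsilon^F$ is the total arc weight; $\phi^k=\min_{F\in\mathcal F^k}\Upsilon^F$, with $\phi^0=\infty$ (so $\infty-\phi^1$ exceeds any real number); $\tilde{\mathcal F}^k=\{F\in\mathcal F^k:\Upsilon^F=\phi^k\}$. It is known that $\phi^{k-1}-\phi^k\ge\phi^k-\phi^{k+1}$ for all $1\le k\le N-1$. $\mathfrak A_k$ is the algebra of subsets of $\mathcal N$ generated by the vertex sets of all trees of all forests in $\tilde{\mathcal F}^k$; atoms are its minimal nonempty elements. A single vertex with no arcs counts as a tree. *)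

(* Defs.v *)
From HB Require Import structures.
From mathcomp Require Import all_boot all_order all_algebra.
From mathcomp Require Import boolp reals.
Set Implicit Arguments. Unset Strict Implicit. Unset Printing Implicit Defensive.
Import Order.TTheory GRing.Theory Num.Theory.
Local Open Scope ring_scope.

(* Digraph V on the finite vertex set T (N = #|T|), arc relation [arc],
   arc weights [w x y] (meaningful when [arc x y]).
   A subgraph in which every vertex has at most one outgoing arc is encoded
   by g : {ffun T -> option T}, g x = Some y meaning the arc x -> y. *)

Section Forests.
Variables (T : finType) (R : realType) (arc : rel T) (w : T -> T -> R).

Definition edge_in (E : {set T}) (g : {ffun T -> option T}) : rel T :=
  fun x y => [&& x \in E, y \in E & (g x == Some y) || (g y == Some x)].

Definition comps (E : {set T}) (g : {ffun T -> option T}) : {set {set T}} :=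
  [set [set y in E | connect (edge_in E g) x y] | x in E].

(* g is a forest with vertex set E using arcs of V:
   at most one outgoing arc per vertex (by encoding), arcs inside E and in V,
   and no directed cycle *)
Definition is_forest_on (E : {set T}) (g : {ffun T -> option T}) : Prop :=
  (forall x y, g x = Some y -> [/\ x \in E, y \in E & arc x y]) /\
  ~ (exists x n, (0 < n)%N /\ iter n (obind (fun z => g z)) (Some x) = Some x).

Definition is_tree_on (E : {set T}) (g : {ffun T -> option T}) : Prop :=
  is_forest_on E g /\ #|comps E g| = 1%N.

Definition kforest (k : nat) (F : {ffun T -> option T}) : Prop :=
  is_forest_on setT F /\ #|comps setT F| = k.

Definition fweight (F : {ffun T -> option T}) : R :=
  \sum_(x : T) (match F x with Some y => w x y | None => 0 end).

(* phi^k = min of the weight over \mathcal F^k (for k >= 1 with F^k nonempty) *)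
Definition phi (k : nat) : R :=
  match [pick F | `[< kforest k F >] ] with
  | Some F0 => \big[Num.min/fweight F0]_(F | `[< kforest k F >]) fweight F
  | None => 0
  end.

Definition optimal (k : nat) (F : {ffun T -> option T}) : Prop :=
  kforest k F /\ fweight F = phi k.

Definition is_algebra (A : {set {set T}}) : bool :=
  [&& set0 \in A,
      [forall S in A, ~: S \in A] &
      [forall S in A, forall S' in A, S :|: S' \in A]].

Definition gen_algebra (G : {set {set T}}) : {set {set T}} :=
  \bigcap_(A : {set {set T}} | is_algebra A && (G \subset A)) A.

Definition alg (k : nat) : {set {set T}} :=
  gen_algebra [set S : {set T} | `[< exists F, optimal k F /\ S \in comps setT F >] ].

Definition atom (A : {set {set T}}) (E : {set T}) : Prop :=
  [/\ E \in A, E != set0 &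
      forall E', E' \in A -> E' \subset E -> E' = set0 \/ E' = E].

Definition restr (F : {ffun T -> option T}) (E : {set T}) : {ffun T -> option T} :=
  [ffun x => if x \in E then
               match F x with Some y => if y \in E then Some y else None
                            | None => None end
             else None].

Definition H (k : nat) : Prop :=
  forall F, optimal k F -> forall E, atom (alg k) E -> is_tree_on E (restr F E).

(* phi^{k-1} - phi^k > phi^k - phi^{k+1}, with phi^0 = +infinity *)
Definition strict_gap (k : nat) : Prop :=
  k = 1%N \/ phi k.-1 - phi k > phi k - phi k.+1.

End Forests.

(* Main.v *)
Require Import Defs.
From HB Require Import structures.
From mathcomp Require Import all_boot all_order all_algebra lra.
From mathcomp Require Import boolp reals.
Set Implicit Arguments. Unset Strict Implicit. Unset Printing Implicit Defensive.
Import Order.TTheory GRing.Theory Num.Theory.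
Local Open Scope nat_scope.

(* [H k] is shown for every k, the case k = 1 being trivial. For k+1 >= 2, charge
   every root the price phi^k - phi^{k+1}; as phi is convex, the minimum forests
   with k and with k+1 trees all minimize the resulting cost. The set O of cost
   minimizers has a product structure: the vertices split into classes such that
   every F in O leaves each class exactly once, and any acyclic forest that
   follows on each class some member of O is again in O. On the quotient graph
   everything is then a matter of free choice of arcs: if F leaves an atom E at
   two vertices x and y, either some member of O puts x and y into different
   trees, and its number of trees can be adjusted to k+1, or all ways out of x
   and y pass through a common class r, and then x or y can only be left towards
   vertices inseparable from it. Both contradict that E is an atom. *)

(** * Acyclic partial maps *)

Section PartialMaps.
Variable T : finType.
Implicit Types (f g : {ffun T -> option T}) (x y z u v : T).

Definition reach f : rel T := connect (fun a b => f a == Some b).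

Definition acyclic f := [forall x, forall y, (f x == Some y) ==> ~~ reach f y x].

Definition rk f x := #|[set y | reach f x y]|.

Definition rootset f : {set T} := [set x | f x == None].

Definition tip f x := odflt x [pick y | reach f x y && (f y == None)].

Definition upd f v o : {ffun T -> option T} := [ffun q => if q == v then o else f q].

Lemma reach_refl f x : reach f x x.
Proof. exact: connect0. Qed.

Lemma reach_trans f x y z : reach f x y -> reach f y z -> reach f x z.
Proof. exact: connect_trans. Qed.

Lemma reach1 f x y : f x = Some y -> reach f x y.
Proof. by move=> e; apply: connect1; rewrite e. Qed.

Lemma reach_cons f x y z : f x = Some y -> reach f y z -> reach f x z.
Proof. by move=> /reach1; apply: reach_trans. Qed.

Lemma reach_ind f y (P : T -> Prop) :
  P y -> (forall x z, f x = Some z -> reach f z y -> P z -> P x) ->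
  forall x, reach f x y -> P x.
Proof.
move=> Py PS x /connectP[p]; elim: p x => [|z p IH] x /=; first by move=> _ <-.
case/andP=> /eqP fx pp ly; apply: (PS _ _ fx); last exact: IH.
by apply/connectP; exists p.
Qed.

Lemma reach_step f x y :
  reach f x y -> x = y \/ exists2 z, f x = Some z & reach f z y.
Proof.
by move=> H; elim/(@reach_ind f y): x / H; [left | move=> x z fx r _; right; exists z].
Qed.

Lemma reach_root f x y : f x = None -> reach f x y -> x = y.
Proof. by move=> fx /reach_step[//|[z]]; rewrite fx. Qed.

Lemma reach_closed f (P : pred T) x y :
  (forall a b, P a -> f a = Some b -> P b) -> P x -> reach f x y -> P y.
Proof.
move=> cl Px r; move: Px; elim/(@reach_ind f y): x / r => // x z fx _ IH Px.
by apply: IH; apply: cl fx.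
Qed.

(** Out-degrees are at most one, so all vertices reachable from [x] lie on a single path. *)
Lemma reach_linear f x y z : reach f x y -> reach f x z -> reach f y z || reach f z y.
Proof.
move=> r; elim/(@reach_ind f y): x / r => [->//|x t fx rt IH].
move=> /reach_step[<-|[t']]; first by rewrite (reach_cons fx rt) orbT.
by rewrite fx => -[<-].
Qed.

Lemma acyclicP f :
  reflect (forall x y, f x = Some y -> ~~ reach f y x) (acyclic f).
Proof.
apply: (iffP forallP) => [H x y /eqP fx|H x].
  by move/forallP: (H x) => /(_ y)/implyP; apply.
by apply/forallP=> y; apply/implyP=> /eqP; apply: H.
Qed.

Lemma acyclic_rank f (r : T -> nat) :
  (forall x y, f x = Some y -> r y < r x) -> acyclic f.
Proof.
move=> H; apply/acyclicP=> x y fx; apply/negP=> ryx.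
suff: r x <= r y by rewrite leqNgt H.
elim/(@reach_ind f x): y / ryx {fx} => // z t /H zt _ le; exact: leq_trans le (ltnW zt).
Qed.

Lemma rk_lt f : acyclic f -> forall x y, f x = Some y -> rk f y < rk f x.
Proof.
move=> /acyclicP H x y fx; apply: proper_card; apply/properP; split.
  by apply/subsetP=> z; rewrite !inE; apply: reach_cons.
by exists x; rewrite !inE ?reach_refl ?H.
Qed.

Lemma rk_le f x : rk f x <= #|T|.
Proof. exact: max_card. Qed.

Lemma rk_reach f x y : acyclic f -> reach f x y -> rk f y <= rk f x.
Proof.
move=> af r; elim/(@reach_ind f y): x / r => // x z fx _ le.
exact: leq_trans le (ltnW (rk_lt af fx)).
Qed.

Lemma reach_anti f x y : acyclic f -> reach f x y -> reach f y x -> x = y.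
Proof.
move=> /acyclicP af /reach_step[//|[z fx rz]] ry.
by have := af _ _ fx; rewrite (reach_trans rz ry).
Qed.

Lemma acyclic_ind f (P : T -> Prop) : acyclic f ->
  (forall x, f x = None -> P x) -> (forall x y, f x = Some y -> P y -> P x) ->
  forall x, P x.
Proof.
move=> af P0 PS x; have [n] := ubnP (rk f x); elim: n x => // n IH x ltn.
case fx: (f x) => [y|]; last exact: P0.
apply: (PS _ _ fx); apply: IH; exact: leq_trans (rk_lt af fx) _.
Qed.

Lemma tipP f x : acyclic f -> reach f x (tip f x) /\ f (tip f x) = None.
Proof.
move=> af; rewrite /tip; case: pickP => [y /andP[? /eqP]//|H]; exfalso.
have [y ry fy] : exists2 y, reach f x y & f y = None.
  move: x {H}; apply: (acyclic_ind af) => [x fx|x y fx [z rz fz]].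
    by exists x => //; exact: reach_refl.
  by exists z => //; exact: reach_cons fx rz.
by have := H y; rewrite ry fy.
Qed.

Lemma tip_root f x : acyclic f -> tip f x \in rootset f.
Proof. by move=> af; rewrite inE (tipP x af).2. Qed.

Lemma tip_uniq f x y : acyclic f -> reach f x y -> f y = None -> tip f x = y.
Proof.
move=> af rxy fy; have [rt ft] := tipP x af.
by case/orP: (reach_linear rxy rt) => /reach_root; [move=> <- | move=> ->].
Qed.

Lemma tip_reach f x y : acyclic f -> reach f x y -> tip f x = tip f y.
Proof.
move=> af rxy; have [rt ft] := tipP y af.
by apply: tip_uniq ft => //; apply: reach_trans rt.
Qed.

Lemma tip_id f x : acyclic f -> f x = None -> tip f x = x.
Proof. by move=> af; apply: tip_uniq => //; apply: reach_refl. Qed.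

Lemma updE f v o x : upd f v o x = if x == v then o else f x.
Proof. by rewrite ffunE. Qed.

Lemma reach_upd_off f v o x y : ~~ reach f x v -> reach (upd f v o) x y = reach f x y.
Proof.
move=> nr; apply/idP/idP=> r; move: nr.
  elim/(@reach_ind (upd f v o) y): x / r => [|x z fx _ IH nr]; first by rewrite reach_refl.
  move: fx; rewrite updE; case: eqP nr => [->|_ nr fx]; first by rewrite reach_refl.
  by apply: (reach_cons fx); apply: IH; apply: contra nr; apply: reach_cons.
elim/(@reach_ind f y): x / r => [|x z fx _ IH nr]; first by rewrite reach_refl.
apply: (@reach_cons _ _ z).
  by rewrite updE; case: eqP nr => [->|//]; rewrite reach_refl.
by apply: IH; apply: contra nr; apply: reach_cons.
Qed.

Lemma reach_upd_to f v o x : reach f x v -> reach (upd f v o) x v.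
Proof.
move=> r; elim/(@reach_ind f v): x / r => [|x z fx _ IH]; first exact: reach_refl.
have [->|xv] := eqVneq x v; first exact: reach_refl.
by apply: (@reach_cons _ _ z) => //; rewrite updE (negPf xv).
Qed.

(** The old path from [x] survives up to [v]; the new one then continues from the head [u] along old
    arcs, since the old path from [u] avoids [v]. *)
Lemma reach_upd_on f v o x y :
  (forall u, o = Some u -> ~~ reach f u v) -> reach f x v -> reach (upd f v o) x y ->
  (reach f x y /\ reach f y v) \/ (exists2 u, o = Some u & reach f u y).
Proof.
move=> ho rxv r; move: rxv.
elim/(@reach_ind (upd f v o) y): x / r => [rv|x z fx rz IH rv]; first by left; split=> //; apply: reach_refl.
move: fx; rewrite updE; case: eqP rv => [-> _ oz|xv rv fx].
  by right; exists z => //; move: rz; rewrite reach_upd_off ?ho.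
have rzv : reach f z v by case: (reach_step rv) => [/xv//|[t]]; rewrite fx => -[<-].
by case: (IH rzv) => [[r1 r2]|]; [left; split=> //; apply: reach_cons r1 | right].
Qed.

Lemma acyclic_upd f v o : acyclic f ->
  (forall u, o = Some u -> ~~ reach f u v) -> acyclic (upd f v o).
Proof.
(* Vertices that reach [v] are lifted above all others; the new arc at [v] drops out of this upper
   layer and no arc re-enters it. *)
move=> af ho; apply: (@acyclic_rank _ (fun x => rk f x + (if reach f x v then #|T| else 0))).
move=> x y; rewrite updE; have [->|xv] := eqVneq x v.
  move=> oy; rewrite reach_refl (negPf (ho _ oy)) addn0.
  apply: (leq_ltn_trans (rk_le f y)); rewrite addnC -addn1 leq_add2l.
  by apply/card_gt0P; exists v; rewrite inE reach_refl.
move=> fx; rewrite -addSn leq_add ?(rk_lt af)//.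
by case: ifP => // ryv; rewrite (reach_cons fx ryv).
Qed.

Lemma tip_upd_off f v o x : acyclic f -> acyclic (upd f v o) ->
  ~~ reach f x v -> tip (upd f v o) x = tip f x.
Proof.
move=> af af' nr; have [rt ft] := tipP x af.
apply: tip_uniq => //; first by rewrite reach_upd_off.
by rewrite updE; case: eqP => // e; rewrite -e rt in nr.
Qed.

Lemma tip_upd_on f v u x : acyclic f -> acyclic (upd f v (Some u)) ->
  ~~ reach f u v -> reach f x v -> tip (upd f v (Some u)) x = tip f u.
Proof.
move=> af af' nr rx; rewrite -(tip_upd_off af af' nr); apply: tip_reach => //.
by apply: reach_trans (reach_upd_to _ rx) _; apply: reach1; rewrite updE eqxx.
Qed.

Lemma tip_upd_None f v x : acyclic f -> acyclic (upd f v None) ->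
  reach f x v -> tip (upd f v None) x = v.
Proof.
by move=> af af' rx; apply: tip_uniq; rewrite ?updE ?eqxx//; apply: reach_upd_to.
Qed.

Lemma rootset_upd_None f v : rootset (upd f v None) = v |: rootset f.
Proof. by apply/setP=> x; rewrite !inE updE; case: (x == v). Qed.

Lemma rootset_upd_Some f v u : rootset (upd f v (Some u)) = rootset f :\ v.
Proof. by apply/setP=> x; rewrite !inE updE; case: (x == v). Qed.

(** A path that enters [P] stays there, so a cycle would lie wholly inside [P] or wholly outside. *)
Lemma acyclic_mix f g (P : pred T) : acyclic f -> acyclic g ->
  (forall x y, P x -> g x = Some y -> P y) ->
  acyclic [ffun x => if P x then g x else f x].
Proof.
move=> af ag cl.
apply: (@acyclic_rank _ (fun x => if P x then rk g x else rk f x + #|T|)) => x y.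
rewrite ffunE /=; case: ifP => [Px gx|_ fx]; first by rewrite (cl _ _ Px gx) rk_lt.
case: ifP => _; last by rewrite ltn_add2r rk_lt.
apply: (leq_ltn_trans (rk_le g y)); rewrite -add1n leq_add2r.
by apply/card_gt0P; exists x; rewrite inE reach_refl.
Qed.

End PartialMaps.

(** * Forests with free choice of arcs *)

Section Choices.
Variables (Q : finType) (A : Q -> option Q -> bool).
Implicit Types (f g : {ffun Q -> option Q}) (q u v e : Q).

Definition admissible f := acyclic f && [forall q, A q (f q)].

Lemma admissible_upd f v o : admissible f -> A v o ->
  (forall u, o = Some u -> ~~ reach f u v) -> admissible (upd f v o).
Proof.
case/andP=> af /forallP Af Avo ho; rewrite /admissible acyclic_upd//=.
by apply/forallP=> q; rewrite updE; case: eqP => [->|].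
Qed.

(** Grow a set [S] carrying a forest with permitted choices, adding any vertex that may be a root or
    may point into [S]. When nothing can be added, the complement of [S] is empty or a trap. *)
Lemma admissible_or_trap :
  (exists f, admissible f) \/
  (exists U : {set Q}, U != set0 /\
     forall q o, q \in U -> A q o -> exists2 q', q' \in U & o = Some q').
Proof.
suff H n (S : {set Q}) f : #|~: S| <= n -> acyclic f ->
    (forall q, q \in S -> A q (f q)) ->
    (forall q q', f q = Some q' -> (q \in S) && (q' \in S)) ->
  (exists f, admissible f) \/
  (exists U : {set Q}, U != set0 /\
     forall q o, q \in U -> A q o -> exists2 q', q' \in U & o = Some q').
  apply: (H #|Q| set0 [ffun=> None]); first exact: max_card.
  - by apply: (@acyclic_rank _ _ (fun=> 0)) => x y; rewrite ffunE.
  - by move=> q; rewrite inE.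
  - by move=> q q'; rewrite ffunE.
elim: n S f => [|n IH] S f leS af AS cS.
  left; exists f; rewrite /admissible af; apply/forallP=> q; apply: AS.
  by move: leS; rewrite leqn0 cards_eq0 => /eqP /setP /(_ q); rewrite !inE => /negPn.
case: (boolP [exists q, [exists o, [&& q \notin S, A q o &
    if o is Some q' then q' \in S else true]]]).
  case/existsP=> q /existsP[o /and3P[qS Aqo oS]].
  have nS u : o = Some u -> u \in S by move=> e; move: oS; rewrite e.
  have nr u : u \in S -> ~~ reach f u q.
    move=> uS; apply: contra qS => r; apply: (reach_closed _ uS r) => a b /= _ fa.
    by case/andP: (cS _ _ fa).
  apply: (IH (q |: S) (upd f q o)).
  - have -> : ~: (q |: S) = (~: S) :\ q.
      by apply/setP=> z; rewrite !inE negb_or.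
    by rewrite -ltnS (leq_trans _ leS)// [X in _ < X](cardsD1 q) inE qS.
  - by apply: acyclic_upd => // u /nS /nr.
  - move=> z; rewrite !inE updE; case: eqP => [->|_] //=; exact: AS.
  - move=> z z'; rewrite updE !inE; case: eqP => [_ /nS ->|_ /cS/andP[-> ->]] /=; by rewrite !orbT.
rewrite negb_exists => /forallP H.
case: (eqVneq (~: S) set0) => [S0|S0].
  left; exists f; rewrite /admissible af; apply/forallP=> q; apply: AS.
  by move/setP: S0 => /(_ q); rewrite !inE => /negPn.
right; exists (~: S); split=> // q o; rewrite inE => qS Aqo.
move: (H q); rewrite negb_exists => /forallP/(_ o).
rewrite qS Aqo /=; case: o Aqo => // q' _ ?; exists q' => //; by rewrite inE.
Qed.

(* The alternative is Menger's theorem for two paths: [r] dominates [Z]. *)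
Lemma separated_or_dominated f0 e1 e2 : admissible f0 ->
  (exists2 f, admissible f & tip f e1 != tip f e2) \/
  (exists r (Z : {set Q}), [/\ e1 \in Z, e2 \in Z &
     forall v o, v \in Z -> v != r -> A v o -> exists2 u, u \in Z & o = Some u]).
Proof.
move=> adm0; case: (boolP [exists f, admissible f && (tip f e1 != tip f e2)]).
  by case/existsP=> f /andP[? ?]; left; exists f.
rewrite negb_exists => /forallP nosep.
have same f : admissible f -> tip f e1 = tip f e2.
  by move=> adm; apply/eqP; move: (nosep f); rewrite adm negbK.
pose com f := [set v | reach f e1 v && reach f e2 v].
pose anc f r := [set u | reach f u r].
have com_tip f : admissible f -> tip f e1 \in com f.
  move=> adm; have af : acyclic f by case/andP: adm.
  rewrite inE (tipP e1 af).1 same//; exact: (tipP e2 af).1.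
pose P (i : {ffun Q -> option Q} * Q) := admissible i.1 && (i.2 \in com i.1).
(* A lexicographic measure: first the common part of the two paths, then the number of vertices that
   reach the chosen common vertex. The factor exceeds the second term. *)
pose m (i : {ffun Q -> option Q} * Q) := #|com i.1| * #|Q|.+1 + #|anc i.1 i.2|.
have P0 : P (f0, tip f0 e1) by rewrite /P adm0 com_tip.
case: (arg_minnP m P0) => -[f r] /andP[/= adm rcom] minm.
have m_com f' : admissible f' -> #|com f'| < #|com f| -> False.
  move=> adm' lt; have := minm (f', tip f' e1); rewrite /P adm' com_tip// => /(_ isT).
  apply/negP; rewrite -ltnNge /m /= -addnS; apply: leq_trans (leq_addr _ _).
  apply: leq_trans (leq_mul lt (leqnn _)); rewrite mulSn addnC leq_add2r ltnS.
  exact: max_card.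
have m_anc f' r' : admissible f' -> #|com f'| <= #|com f| -> r' \in com f' ->
    anc f' r' \proper anc f r -> False.
  move=> adm' le r'com /proper_card lt.
  have := minm (f', r'); rewrite /P adm' r'com => /(_ isT).
  apply/negP; rewrite -ltnNge /m /= -addnS; apply: leq_add => //.
  by rewrite leq_mul2r le orbT.
have af : acyclic f by case/andP: adm.
have /andP[e1r e2r] : reach f e1 r && reach f e2 r by rewrite inE in rcom.
right; exists r, (anc f r); split; rewrite ?inE // => v o.
rewrite inE => vr vNr Avo.
case: (boolP [exists u, (u \in anc f r) && (o == Some u)]).
  by case/existsP=> u /andP[? /eqP]; exists u.
(* Otherwise the choice [o] at [v] escapes from the vertices that reach [r]; making this choice will
   contradict the minimality. *)
rewrite negb_exists => /forallP ho; exfalso.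
have hr u : o = Some u -> ~~ reach f u r.
  by move=> e; move: (ho u); rewrite e eqxx andbT inE.
have hv u : o = Some u -> ~~ reach f u v.
  by move=> /hr; apply: contra => r1; apply: reach_trans vr.
have rv : ~~ reach f r v.
  by apply: contra vNr => r1; rewrite (reach_anti af vr r1).
have adm' := admissible_upd adm Avo hv.
(* if only [e] is diverted at [v], the common part of the two paths loses [r] *)
have one e e' : com f = [set w | reach f e w && reach f e' w] ->
    com (upd f v o) = [set w | reach (upd f v o) e w && reach (upd f v o) e' w] ->
    reach f e v -> ~~ reach f e' v -> False.
  move=> cE cE' ev e'v; apply: (m_com _ adm'); rewrite cE'; apply: proper_card.
  have /andP[er e'r] : reach f e r && reach f e' r by move: rcom; rewrite cE inE.
  apply/properP; split; last first.
    exists r => //; rewrite inE; apply/negP=> /andP[/(reach_upd_on hv ev) H _].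
    case: H => [[_ ]|[u /hr]]; [exact/negP | by move=> /negPf ->].
  apply/subsetP=> w; rewrite cE !inE (@reach_upd_off _ f v o e')// => /andP[/(reach_upd_on hv ev) H e'w].
  rewrite e'w andbT; case: H => [[]//|[u /hr ur uw]].
  case/orP: (reach_linear e'r e'w) => [rw|wr]; first exact: reach_trans rw.
  by rewrite (reach_trans uw wr) in ur.
(* If both paths pass [v], then [v] is a better common vertex than [r]. If neither does, the change
   at [v] keeps the common part and removes [v] from the vertices that reach [r]. *)
case: (boolP (reach f e1 v)) => e1v; case: (boolP (reach f e2 v)) => e2v.
- apply: (m_anc f v adm (leqnn _)); first by rewrite inE e1v.
  apply/properP; split; last by exists r; rewrite inE ?reach_refl.
  by apply/subsetP=> z; rewrite !inE => zv; apply: reach_trans vr.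
- exact: (one e1 e2).
- by apply: (one e2 e1) => //; apply/setP=> w; rewrite !inE andbC.
- have cE : com (upd f v o) = com f by apply/setP=> w; rewrite !inE !reach_upd_off.
  apply: (m_anc _ r adm'); rewrite ?cE//.
  have nv : ~~ reach (upd f v o) v r.
    apply/negP=> /(reach_upd_on hv (reach_refl f v)) [[_]|[u /hr]]; first exact/negP.
    by move/negPf=> ->.
  apply/properP; split; last by exists v; rewrite inE.
  apply/subsetP=> z; rewrite !inE => zr.
  case: (boolP (reach f z v)) => zv; first exact: reach_trans vr.
  by rewrite reach_upd_off in zr.
Qed.

(** While roots are missing, some root [v] of [g] is not a root of [f]. Cutting the arc at [v] adds
    one root and separates whatever was separated, as [v] is not the tip of any vertex under [f]. *)
Lemma separated_more_roots n g f e1 e2 : admissible g -> n <= #|rootset g| ->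
  admissible f -> #|rootset f| <= n -> tip f e1 != tip f e2 ->
  exists f', [/\ admissible f', #|rootset f'| = n & tip f' e1 != tip f' e2].
Proof.
move=> admg ng admf; move: {2}(n - _) (erefl (n - #|rootset f|)) => d.
elim: d f admf => [|d IH] f admf dE le sep.
  by exists f; split=> //; apply/eqP; rewrite eqn_leq le /= -subn_eq0 dE.
have lt : #|rootset f| < n by rewrite -subn_gt0 dE.
have [v vg vf] : exists2 v, v \in rootset g & v \notin rootset f.
  apply/subsetPn; apply/negP=> /subset_leq_card; apply/negP.
  by rewrite -ltnNge; apply: leq_trans ng.
have Av : A v None.
  by move: vg; rewrite inE; case/andP: admg => _ /forallP/(_ v) + /eqP => /[swap] ->.
have adm' : admissible (upd f v None) by apply: admissible_upd.
have [af af'] : acyclic f /\ acyclic (upd f v None).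
  by case/andP: admf; case/andP: adm'.
have cr : #|rootset (upd f v None)| = #|rootset f|.+1 by rewrite rootset_upd_None cardsU1 vf.
apply: (IH _ adm'); first by rewrite cr subnS dE.
  by rewrite cr.
have tv e : reach f e v -> tip (upd f v None) e = v by apply: tip_upd_None.
have tn e : ~~ reach f e v -> tip (upd f v None) e = tip f e by apply: tip_upd_off.
have tvv e : tip f e != v by apply: contraNneq vf => <-; apply: tip_root.
case: (boolP (reach f e1 v)) => r1; case: (boolP (reach f e2 v)) => r2.
- by case/negP: sep; rewrite (tip_reach af r1) (tip_reach af r2).
- by rewrite tv// tn// eq_sym.
- by rewrite tn// tv.
- by rewrite !tn.
Qed.

(* Merging the trees of [e1] and [e2] into one block leaves a block without
   roots of [p]; some arc of [p] leaves this block and is added to [f]. *)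
Lemma separated_fewer_roots n p f e1 e2 : admissible p -> #|rootset p| < n ->
  admissible f -> n <= #|rootset f| -> tip f e1 != tip f e2 ->
  exists f', [/\ admissible f', #|rootset f'| = n & tip f' e1 != tip f' e2].
Proof.
move=> admp pn admf.
(* The new arc at [v] may replace an arc of [f] instead of using up a root; it then still removes
   one disagreement with [p]. *)
have [d] := ubnP (#|rootset f| + #|[set q | f q != p q]|).
elim: d f admf => // d IH f admf ltd le sep.
move: le; rewrite leq_eqVlt => /orP[/eqP nE|lt]; first by exists f.
have [af ap] : acyclic f /\ acyclic p by case/andP: admf; case/andP: admp.
pose t q := if tip f q == tip f e2 then tip f e1 else tip f q.
(* After the merging, [f] still has at least [n] blocks, more than [p] has roots; so some block,
   labelled [a], contains no root of [p]. *)
have [a] : exists2 a, a \in rootset f :\ tip f e2 & a \notin t @: rootset p.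
  apply/subsetPn; apply/negP=> /subset_leq_card; apply/negP; rewrite -ltnNge.
  apply: (leq_ltn_trans (leq_imset_card _ _)); apply: (leq_trans pn).
  by rewrite -ltnS (leq_trans lt)// (cardsD1 (tip f e2)) tip_root.
rewrite !inE => /andP[ane2 /eqP fa] aNp.
have ta : t a = a by rewrite /t (tip_id af fa) (negPf ane2).
have [v [u [tv pv tu]]] : exists v u, [/\ t v = a, p v = Some u & t u != a].
  apply: contrapT => H; case/negP: aNp; apply/imsetP; exists (tip p a); first exact: tip_root.
  have cl x y : t x == a -> p x = Some y -> t y == a.
    move=> /eqP tx px; apply/negPn/negP=> ty; apply: H; by exists x, y.
  (* If no arc of [p] left the block, the path of [p] from [a] would end at a root inside it. *)
  apply/esym/eqP; apply: (reach_closed cl _ (tipP a ap).1); exact/eqP.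
have tuv : tip f u != tip f v.
  by apply: contra tu => /eqP e; rewrite -tv /t e.
have nr : ~~ reach f u v by apply: contra tuv => /(tip_reach af) ->.
have Av : A v (Some u) by rewrite -pv; case/andP: admp => _ /forallP.
have adm' : admissible (upd f v (Some u)).
  by apply: admissible_upd => // _ [<-].
have af' : acyclic (upd f v (Some u)) by case/andP: adm'.
have fpv : f v != p v.
  rewrite pv; apply: contra tuv => /eqP fv; rewrite (@tip_reach _ f v u)//; exact: reach1.
have dE : [set q | upd f v (Some u) q != p q] = [set q | f q != p q] :\ v.
  apply/setP=> q; rewrite !inE updE; case: (eqVneq q v) => [->|//]; by rewrite pv eqxx.
have cr : #|rootset f| <= #|rootset (upd f v (Some u))|.+1.
  by rewrite rootset_upd_Some (cardsD1 v (rootset f)) -add1n leq_add2r; case: (v \in _).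
apply: (IH _ adm').
- rewrite dE -ltnS; apply: leq_trans ltd; rewrite ltnS.
  rewrite [X in _ < _ + X](cardsD1 v) inE fpv add1n addnS ltnS leq_add2r.
  by rewrite rootset_upd_Some subset_leq_card ?subD1set.
- by rewrite -ltnS; apply: leq_trans cr.
have ton e : reach f e v -> tip (upd f v (Some u)) e = tip f u by apply: tip_upd_on.
have toff e : ~~ reach f e v -> tip (upd f v (Some u)) e = tip f e by apply: tip_upd_off.
case: (boolP (reach f e1 v)) => r1; case: (boolP (reach f e2 v)) => r2.
- by case/negP: sep; rewrite (tip_reach af r1) (tip_reach af r2).
- rewrite ton// toff//; apply: contra tu => /eqP e.
  by rewrite -tv /t e eqxx -(tip_reach af r1) (negPf sep).
- rewrite toff// ton//; apply: contra tu => /eqP e.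
  by rewrite -tv /t -e -(tip_reach af r2) eqxx (negPf sep).
- by rewrite !toff.
Qed.

End Choices.

(** * Classes of optimal forests *)

Section Quotient.
Variables (T Q : finType) (cls : T -> Q).
Implicit Types (F : {ffun T -> option T}) (s : Q -> {ffun T -> option T}).

(** Since [omap cls None] is [None], a root counts as an exit of its class. *)
Definition exitp F x := omap cls (F x) != Some (cls x).

(* every class of [cls] is left by exactly one arc of [F] (or contains exactly
   one root), at the vertex given by [e] *)
Definition exits F (e : Q -> T) :=
  forall q x, (cls x == q) && exitp F x = (x == e q).

Definition quot F : {ffun Q -> option Q} :=
  [ffun q => obind (fun x => omap cls (F x)) [pick x | (cls x == q) && exitp F x]].

Definition mix s : {ffun T -> option T} := [ffun x => s (cls x) x].

Section OneForest.
Variables (F : {ffun T -> option T}) (e : Q -> T).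
Hypotheses (aF : acyclic F) (exF : exits F e).

Lemma cls_exit q : cls (e q) = q.
Proof. by have := exF q (e q); rewrite eqxx => /andP[/eqP]. Qed.

Lemma exitpE x : exitp F x = (x == e (cls x)).
Proof. by rewrite -exF eqxx. Qed.

Lemma quotE q : quot F q = omap cls (F (e q)).
Proof.
rewrite ffunE; case: pickP => [x|/(_ (e q))]; first by rewrite exF => /eqP ->.
by rewrite exF eqxx.
Qed.

(** The path from [x] must end or leave the class, and either happens only at the exit. *)
Lemma reach_exit x : reach F x (e (cls x)).
Proof.
move: x; apply: (acyclic_ind aF) => [x Fx|x y Fx IH].
  have : exitp F x by rewrite /exitp Fx.
  by rewrite exitpE => /eqP {1}->; apply: reach_refl.
case: (boolP (exitp F x)) => [|]; first by rewrite exitpE => /eqP {1}->; apply: reach_refl.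
by rewrite /exitp Fx /= negbK => /eqP[<-]; apply: reach_cons IH.
Qed.

Lemma reach_quot x y : reach F x y -> reach (quot F) (cls x) (cls y).
Proof.
move=> r; elim/(@reach_ind _ F y): x / r => [|x z Fx _ IH]; first exact: reach_refl.
case: (eqVneq (cls z) (cls x)) => [<-//|ne]; apply: reach_cons IH.
have : exitp F x by rewrite /exitp Fx.
by rewrite exitpE quotE => /eqP <-; rewrite Fx.
Qed.

(** An arc between classes enters the next class at some vertex, from which [F] leads on to that
    class's exit; hence the ranks of the exits decrease. *)
Lemma quot_acyclic : acyclic (quot F).
Proof.
apply: (@acyclic_rank _ _ (fun q => rk F (e q))) => p q; rewrite quotE.
case Fp: (F (e p)) => [y|//] [<-].
exact: leq_ltn_trans (rk_reach aF (reach_exit y)) (rk_lt aF Fp).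
Qed.

Lemma root_exit x : F x = None -> x = e (cls x).
Proof. by move=> Fx; apply/eqP; rewrite -exitpE /exitp Fx. Qed.

Lemma tip_quot x : tip (quot F) (cls x) = cls (tip F x).
Proof.
have [rt Ft] := tipP x aF; apply: (tip_uniq quot_acyclic); first exact: reach_quot.
by rewrite quotE -root_exit// Ft.
Qed.

Lemma tip_quot_eq x y :
  (tip (quot F) (cls x) == tip (quot F) (cls y)) = (tip F x == tip F y).
Proof.
rewrite !tip_quot; apply/eqP/eqP=> [E|->//].
by rewrite (root_exit (tipP x aF).2) (root_exit (tipP y aF).2) E.
Qed.

Lemma card_rootset_quot : #|rootset (quot F)| = #|rootset F|.
Proof.
rewrite -(card_imset _ (can_inj cls_exit)); congr #|pred_of_set _|.
apply/setP=> x; apply/imsetP/idP=> [[q]|].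
  by rewrite !inE quotE => + ->; case: (F (e q)).
rewrite inE => /eqP Fx; exists (cls x); last exact: root_exit.
by rewrite inE quotE -root_exit// Fx.
Qed.

End OneForest.

Lemma mix_quot s q : quot (mix s) q = quot (s q) q.
Proof.
have E x : (cls x == q) && exitp (mix s) x = (cls x == q) && exitp (s q) x.
  by case: eqP => // <-; rewrite /exitp ffunE.
rewrite !ffunE (eq_pick E); case: pickP => // x /andP[/eqP <- _] /=.
by rewrite ffunE.
Qed.

Lemma mix_acyclic s : (forall q, acyclic (s q)) -> (forall q, exists e, exits (s q) e) ->
  acyclic [ffun q => quot (s q) q] -> acyclic (mix s).
Proof.
move=> as_ es; set f := [ffun _ => _] => af.
(* Lexicographic rank: the quotient forest decides between classes, the forest chosen for a class
   decides inside it. *)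
apply: (@acyclic_rank _ _ (fun x => rk f (cls x) * #|T|.+1 + rk (s (cls x)) x)) => x y.
rewrite ffunE => sx; have [cE|cN] := eqVneq (cls y) (cls x).
  by rewrite cE ltn_add2l rk_lt.
have [e ee] := es (cls x).
have lt : rk f (cls y) < rk f (cls x).
  apply: rk_lt => //; rewrite ffunE (quotE ee).
  by rewrite -(eqP (_ : x == e (cls x))) ?sx// -(exitpE ee) /exitp sx.
apply: leq_trans (leq_addr _ _); apply: leq_trans (leq_mul lt (leqnn _)).
by rewrite mulSn -addnS addnC leq_add2r ltnS rk_le.
Qed.

End Quotient.

(** * Product structure of the set of cost minimizers *)

Section OptimalForests.
Variables (T : finType) (R : realDomainType).
Variables (ok : T -> option T -> bool) (c : T -> option T -> R).
Implicit Types (F G : {ffun T -> option T}).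

Definition cost F : R := (\sum_x c x (F x))%R.

Definition opt : {set {ffun T -> option T}} :=
  [set F | admissible ok F & [forall G, admissible ok G ==> (cost F <= cost G)%R]].

Lemma optP F :
  reflect (admissible ok F /\ forall G, admissible ok G -> (cost F <= cost G)%R)
          (F \in opt).
Proof.
rewrite inE; apply: (iffP andP) => -[adF H]; split=> //.
  by move=> G adG; move/forallP: H => /(_ G)/implyP; apply.
by apply/forallP=> G; apply/implyP; apply: H.
Qed.

Definition tight (Q : finType) (cls : T -> Q) :=
  forall F, F \in opt -> exists e, exits cls F e.

Section Step.
Variables (Q : finType) (cls : T -> Q).
Hypothesis cls_tight : tight cls.

Let mu F q : R := (\sum_(x | cls x == q) c x (F x))%R.

Lemma cost_classes F : cost F = (\sum_q mu F q)%R.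
Proof. by rewrite /cost (partition_big cls xpredT). Qed.

Lemma mu_mix s q : mu (mix cls s) q = mu (s q) q.
Proof. by apply: eq_bigr => x /eqP <-; rewrite ffunE. Qed.

Lemma mix_admissible s : (forall q, s q \in opt) ->
  acyclic [ffun q => quot cls (s q) q] -> admissible ok (mix cls s).
Proof.
move=> so af; rewrite /admissible mix_acyclic//=.
- apply/forallP=> x; rewrite ffunE; have /optP[/andP[_ /forallP]] := so (cls x); exact.
- by move=> q; have /optP[/andP[]] := so q.
- by move=> q; apply: cls_tight.
Qed.

Lemma eq_of_ler_sum (f g : Q -> R) : (forall q, f q <= g q)%R ->
  (\sum_q g q <= \sum_q f q)%R -> forall q, f q = g q.
Proof.
move=> le; rewrite -subr_le0 -sumrB => le0 q; apply/esym/eqP; rewrite -subr_eq0; apply/eqP.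
have ge0 i : true -> (0 <= g i - f i)%R by rewrite subr_ge0.
have S0 : (\sum_i (g i - f i) = 0)%R by apply/eqP; rewrite eq_le le0 sumr_ge0.
exact: (psumr_eq0P ge0 S0).
Qed.

(* Chu-Liu/Edmonds contraction: if the cheapest exits [B] of the classes do not
   contain a spanning forest, a minimal set of classes closed under [B] is left
   only once by every optimal forest, so it can be merged into one class. *)
Lemma mixable_or_merge : opt != set0 ->
  (forall s, (forall q, s q \in opt) -> acyclic [ffun q => quot cls (s q) q] ->
     mix cls s \in opt) \/
  exists (Q' : finType) (cls' : T -> Q'), #|Q'| < #|Q| /\ tight cls'.
Proof.
case/set0Pn=> F0 F0opt.
have minF q : exists2 F, F \in opt & forall G, G \in opt -> (mu F q <= mu G q)%R.
  by case: (Order.TotalTheory.arg_minP (fun F => mu F q) F0opt) => F ? ?; exists F.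
(* [B q o] holds if [o] is the quotient arc at [q] of some optimal forest that is cheapest on the
   class [q]. *)
pose B q o := [exists F in opt, [forall G in opt, (mu F q <= mu G q)%R] && (quot cls F q == o)].
have Bsel (f : {ffun Q -> option Q}) q : B q (f q) -> exists F, [/\ F \in opt,
    forall G, G \in opt -> (mu F q <= mu G q)%R & quot cls F q = f q].
  case/existsP=> F /and3P[Fo /forallP H /eqP E]; exists F; split=> // G Go.
  by move/implyP: (H G); apply.
have cost_le F G : F \in opt -> admissible ok G -> (cost F <= cost G)%R.
  by move=> /optP[_]; apply.
case: (admissible_or_trap B) => [[f /andP[af /forallP Bf]]|[U0 [U0n U0c]]].
  left; have [m mP] := choice (fun q => Bsel f q (Bf q)).
  have mo q : m q \in opt by case: (mP q).
  have mle q G : G \in opt -> (mu (m q) q <= mu G q)%R by case: (mP q) => _ + _; apply.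
  have adm : admissible ok (mix cls m).
    apply: mix_admissible => //; rewrite (_ : [ffun _ => _] = f)//.
    by apply/ffunP=> q; rewrite ffunE; case: (mP q).
  (* The mix of cheapest parts is itself admissible, so an optimal forest cannot exceed the minimum
     on any class. All optimal forests thus cost the same on each class, and every acyclic mix of
     them is optimal. *)
  have muE F q : F \in opt -> mu (m q) q = mu F q.
    move=> Fo; move: q; apply: eq_of_ler_sum => [q|]; first exact: mle.
    rewrite -cost_classes; apply: le_trans (cost_le _ _ Fo adm) _.
    by rewrite cost_classes; under eq_bigr do rewrite mu_mix.
  move=> s so sa; apply/optP; split=> [|G adG]; first exact: mix_admissible.
  apply: le_trans (cost_le _ _ F0opt adG); rewrite !cost_classes.
  by apply: ler_sum => q _; rewrite mu_mix -(muE (s q))// -(muE F0).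
right; pose closed (U : {set Q}) := (U != set0) &&
  [forall q in U, forall o, B q o ==> [exists q' in U, o == Some q']].
have closedP (U : {set Q}) : U != set0 ->
    (forall q o, q \in U -> B q o -> exists2 q', q' \in U & o = Some q') -> closed U.
  move=> Un Uc; rewrite /closed Un; apply/forallP=> q; apply/implyP=> qU.
  apply/forallP=> o; apply/implyP=> /(Uc _ _ qU)[q' q'U ->].
  by apply/existsP; exists q'; rewrite q'U eqxx.
have [U /minsetP[/andP[Un /forallP Uc'] Umin] _] := minset_exists (closedP _ U0n U0c).
have Uc q o : q \in U -> B q o -> exists2 q', q' \in U & o = Some q'.
  move=> qU; have /implyP/(_ qU)/forallP/(_ o)/implyP H := Uc' q.
  by move=> /H /existsP[q' /andP[? /eqP]]; exists q'.
(* By minimality of [U], cheapest arcs can lead all of [U] to any prescribed [j]: a trap avoiding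
   [j] would be a smaller closed set. *)
have toward j : j \in U -> exists f : {ffun Q -> option Q}, [/\ acyclic f, f j = None &
    forall q, q \in U -> q != j -> B q (f q)].
  move=> jU.
  pose B' q o := if (q \in U) && (q != j) then B q o else o == None.
  case: (admissible_or_trap B') => [[f /andP[af /forallP Bf]]|[V [Vn Vc]]].
    exists f; split=> //; first by have := Bf j; rewrite /B' eqxx andbF => /eqP.
    by move=> q qU qj; have := Bf q; rewrite /B' qU qj.
  have VU q : q \in V -> (q \in U) && (q != j).
    move=> qV; apply: contraT => nq.
    by have [|q' _ //] := Vc q None qV; rewrite /B' (negPf nq).
  have VUs : V \subset U by apply/subsetP=> q /VU/andP[].
  suff /Umin/(_ VUs) VE : closed V by move: jU; rewrite -VE => /VU; rewrite eqxx andbF.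
  by apply: closedP => // q o qV Bqo; apply: (Vc q) => //; rewrite /B' VU.
have one_exit F : F \in opt -> exists j, [/\ j \in U,
    forall q, quot cls F j = Some q -> q \notin U &
    forall q, q \in U -> q != j -> exists2 q', q' \in U & quot cls F q = Some q'].
  move=> Fo; have [e ee] := cls_tight Fo.
  have /optP[/andP[aF _] _] := Fo.
  have aq := quot_acyclic aF ee; set f := quot cls F in aq *.
  have [j0 j0U] := set0Pn _ Un.
  case: (arg_minnP (rk f) j0U) => j jU jmin; exists j; split=> // [q fj|q0 q0U q0j].
    by apply/negP=> /jmin; rewrite leqNgt rk_lt.
  (* Since [j] has least rank in [U], its own arc leaves [U]. The other classes of [U] are now
     redirected towards [j] by cheapest arcs. *)
  have [h [ah hj Bh]] := toward j jU.
  have selq q : exists M, M \in opt /\ (if (q \in U) && (q != j) then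
      (forall G, G \in opt -> (mu M q <= mu G q)%R) /\ quot cls M q = h q else M = F).
    case: (boolP (_ && _)) => [/andP[qU qj]|_]; last by exists F.
    by have [M [? ? ?]] := Bsel h q (Bh q qU qj); exists M.
  have [s sP] := choice selq.
  have so q : s q \in opt by case: (sP q).
  have sin q : q \in U -> q != j ->
      (forall G, G \in opt -> (mu (s q) q <= mu G q)%R) /\ quot cls (s q) q = h q.
    by move=> qU qj; case: (sP q); rewrite qU qj.
  have sout q : ~~ ((q \in U) && (q != j)) -> s q = F.
    by move=> /negPf nq; case: (sP q); rewrite nq.
  have sa : acyclic [ffun q => quot cls (s q) q].
    pose N := #|Q|.+1.
    (* The classes of [U] are placed directly above [j] in the order of [h]; classes outside [U]
       that ranked above [j] are lifted by [N], which exceeds every rank of [h]. *)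
    apply: (@acyclic_rank _ _ (fun q => if q \in U then rk f j + (if q == j then 0 else rk h q)
      else if rk f q <= rk f j then rk f q else rk f q + N)) => p q; rewrite ffunE.
    have [pin|pout] := boolP ((p \in U) && (p != j)).
      case/andP: (pin) => pU pj; have [_ ->] := sin _ pU pj => hp.
      have [q' q'U] := Uc _ _ pU (Bh _ pU pj); rewrite hp => -[qE].
      rewrite pU (negPf pj) qE q'U ltn_add2l -qE.
      by case: eqP => _; [apply: leq_ltn_trans (rk_lt ah hp) | apply: rk_lt].
    rewrite (sout _ pout) => fp; have lt := rk_lt aq fp.
    case: (boolP (p \in U)) => pU.
      have pj : p = j by apply/eqP; move: pout; rewrite pU negbK.
      rewrite pj eqxx addn0; case: ifP => qU; first by have := jmin _ qU; rewrite leqNgt -pj lt.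
      by rewrite -pj (ltnW lt).
    case: ifP => qU.
      have jp : rk f j < rk f p by apply: leq_ltn_trans (jmin _ qU) lt.
      rewrite [rk f p <= _]leqNgt jp /= -addSn; apply: leq_add => //.
      by case: ifP => // _; apply: leqW; apply: rk_le.
    case: ifP => ql; case: ifP => pl //; last by rewrite ltn_add2r.
      exact: ltn_addr.
    by move: ql; rewrite (leq_trans (ltnW lt) pl).
  (* The redirected forest is nowhere dearer than the optimal [F], so the costs agree on each class.
     Thus [F] is cheapest on [q0] too, and its arc there belongs to [B] and stays in [U]. *)
  have muE : mu (s q0) q0 = mu F q0.
    move: (q0); apply: (@eq_of_ler_sum (fun q => mu (s q) q) (mu F)) => [q|].
      have [/andP[qU qj]|/sout -> //] := boolP ((q \in U) && (q != j)).
      by case: (sin _ qU qj) => + _; apply.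
    rewrite -cost_classes; apply: le_trans (cost_le _ _ Fo (mix_admissible so sa)) _.
    by rewrite cost_classes; under eq_bigr do rewrite mu_mix.
  apply: (Uc q0) => //; apply/existsP; exists F; rewrite Fo eqxx andbT.
  apply/forallP=> G; apply/implyP=> Go; rewrite -muE.
  by case: (sin _ q0U q0j) => + _; apply.
(* [None] is the merged class: [insub (cls x)] is [None] exactly when [cls x] lies in [U]. *)
pose Q' : finType := option {q | q \notin U}.
exists Q', (fun x => insub (cls x)); split.
  (* The number of classes drops because [U] has at least two elements: a cheapest arc from [q]
     stays in [U] and is not a loop. *)
  have [q qU] := set0Pn _ Un; have [F Fo Fmin] := minF q.
  have [q' q'U qE] : exists2 q', q' \in U & quot cls F q = Some q'.
    apply: (Uc q) => //; apply/existsP; exists F; rewrite Fo eqxx andbT.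
    by apply/forallP=> G; apply/implyP; apply: Fmin.
  have qq' : q' != q.
    have [e ee] := cls_tight Fo; have /optP[/andP[aF _] _] := Fo.
    apply/eqP=> E; have /acyclicP/(_ _ _ qE) := quot_acyclic aF ee.
    by rewrite E reach_refl.
  rewrite card_option card_sig -(cardC (mem U)).
  have -> : #|[pred x | x \notin U]| = #|[predC U]| by apply: eq_card => x; rewrite !inE.
  rewrite -[X in X < _]add1n ltn_add2r.
  by rewrite (cardD1 q) qU (cardD1 q') !inE qq' q'U.
move=> F Fo; have [e ee] := cls_tight Fo; have [j [jU jN jP]] := one_exit F Fo.
exists (fun q' => if q' is Some q then e (val q) else e j) => q' x.
have insubE y : (insub (cls y) : Q') = None <-> cls y \in U.
  by case: insubP => [u /negPf -> _|/negPn ->].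
have insub_eq y z : (insub (cls y) == insub (cls z) :> Q') =
    ((cls y == cls z) || (cls y \in U) && (cls z \in U)).
  case: insubP => [u uU uE|/negPn yU]; case: insubP => [v vU vE|/negPn zU].
  - by rewrite (negPf uU) orbF -uE -vE; apply/eqP/eqP=> [[->]//|E]; congr Some; apply: val_inj.
  - by rewrite (negPf uU) orbF; apply/esym/negP=> /eqP E; rewrite E zU in uU.
  - by rewrite (negPf vU) andbF orbF; apply/esym/negP=> /eqP E; rewrite -E yU in vU.
  - by rewrite yU zU orbT.
(* Merging keeps every exit except those of the classes of [U] other than [j], whose arcs become
   internal. *)
have exE : exitp (fun x => insub (cls x) : Q') F x =
    exitp cls F x && ~~ ((cls x \in U) && (cls x != j)).
  rewrite /exitp; case Fx: (F x) => [y|]; last first.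
    rewrite /=; apply/esym/negP=> /andP[xU xj].
    have [q'' _] := jP _ xU xj; rewrite (quotE ee).
    by rewrite -(eqP (_ : x == e (cls x))) ?Fx// -(exitpE ee) /exitp Fx.
  rewrite /= [X in ~~ X]insub_eq; have [<-|ne] := eqVneq (cls y) (cls x).
    by rewrite eqxx.
  have xE : x = e (cls x) by apply/eqP; rewrite -(exitpE ee) /exitp Fx.
  have -> : (Some (cls y) != Some (cls x)) by apply: contra ne => /eqP[->].
  congr (~~ _); apply/andP/andP=> -[].
    move=> yU xU; split=> //; apply/negP=> /eqP xj.
    by have := jN (cls y); rewrite yU (quotE ee) -xj -xE Fx => /(_ erefl).
  move=> xU xj; have [q'' q''U] := jP _ xU xj; rewrite (quotE ee) -xE Fx => -[->].
  by split.
case: q' => [[q qU]|] /=.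
  rewrite -ee exE; have -> : (insub (cls x) == Some (Sub q qU) :> Q') = (cls x == q).
    case: insubP => [u uU uE|/negPn xU]; last by apply/esym/negP=> /eqP E; rewrite -E xU in qU.
    by rewrite -uE; apply/eqP/eqP=> [[->]//|E]; congr Some; apply: val_inj.
  by case: eqP => // ->; rewrite (negPf qU) andbT.
rewrite -ee exE; have -> : (insub (cls x) == None :> Q') = (cls x \in U).
  by apply/eqP/idP => /insubE.
case: eqP => [->|_]; first by rewrite jU andbF andbT.
by case: (cls x \in U); rewrite ?andbF.
Qed.
End Step.

(** Start from singleton classes, which are tight because a forest has no loops, and merge until
    mixing works; each merge lowers the number of classes. *)
Theorem optimal_mixable : opt != set0 -> exists (Q : finType) (cls : T -> Q),
  tight cls /\ forall s, (forall q, s q \in opt) ->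
    acyclic [ffun q => quot cls (s q) q] -> mix cls s \in opt.
Proof.
move=> on; suff H n (Q : finType) (cls : T -> Q) : #|Q| < n -> tight cls ->
    exists (Q : finType) (cls : T -> Q), tight cls /\
    forall s, (forall q, s q \in opt) ->
    acyclic [ffun q => quot cls (s q) q] -> mix cls s \in opt.
  apply: (H #|T|.+1 T id) => // F /optP[/andP[aF _] _]; exists id => q x.
  have -> : exitp id F x.
    rewrite /exitp; case Fx: (F x) => [y|//] /=; apply/eqP=> -[yx].
    by have /acyclicP/(_ _ _ Fx) := aF; rewrite yx reach_refl.
  by rewrite andbT.
elim: n Q cls => // n IH Q cls ltn tc.
case: (mixable_or_merge tc on) => [H|[Q' [cls' [lt tc']]]]; first by exists Q, cls.
exact: (IH Q' cls' (leq_trans lt ltn) tc').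
Qed.

End OptimalForests.

(** * Components and convexity *)

Section Components.
Variable T : finType.
Implicit Types (g F : {ffun T -> option T}) (E : {set T}).

Lemma iter_obind_None g n : iter n (obind (fun z => g z)) None = None.
Proof. by elim: n => //= n ->. Qed.

Lemma reach_iter g x y :
  reach g x y <-> exists n, iter n (obind (fun z => g z)) (Some x) = Some y.
Proof.
split=> [r|[n]].
  elim/(@reach_ind _ g y): x / r => [|x z gx _ [n IH]]; first by exists 0.
  by exists n.+1; rewrite iterSr /= gx.
elim: n x => [x [->]|n IH x]; first exact: reach_refl.
rewrite iterSr /=; case gx: (g x) => [z|]; first by move=> /IH; apply: reach_cons.
by rewrite iter_obind_None.
Qed.

Lemma no_cycle_acyclic g :
  ~ (exists x n, 0 < n /\ iter n (obind (fun z => g z)) (Some x) = Some x) <->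
  acyclic g.
Proof.
split=> [H|/acyclicP ag [x [n [n0]]]].
  apply/acyclicP=> x y gx; apply/negP=> /reach_iter[n yx]; apply: H.
  by exists x, n.+1; split=> //; rewrite iterSr /= gx.
case: n n0 => // n _; rewrite iterSr /=; case gx: (g x) => [z|].
  by move=> it; case/negP: (ag _ _ gx); apply/reach_iter; exists n.
by rewrite iter_obind_None.
Qed.

(** Arcs preserve the tip, and every vertex is joined to its tip; so weak connectivity is equality
    of tips. *)
Lemma connect_edge_in E g x y : acyclic g ->
  (forall x y, g x = Some y -> x \in E /\ y \in E) ->
  connect (edge_in E g) x y = (tip g x == tip g y).
Proof.
move=> ag gE; have up z : connect (edge_in E g) z (tip g z).
  have [rt _] := tipP z ag; move: (tip g z) rt => t r.
  elim/(@reach_ind _ g t): z / r => [|z u gz _ IH]; first exact: connect0.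
  apply: connect_trans IH; apply: connect1; have [zE uE] := gE _ _ gz.
  by rewrite /edge_in zE uE gz eqxx.
have sym : connect_sym (edge_in E g).
  by apply: sym_connect_sym => a b; rewrite /edge_in andbCA orbC.
apply/idP/eqP=> [/connectP[p]|E1].
  elim: p x => [|z p IH] x /=; first by move=> _ ->.
  case/andP=> /and3P[_ _ xz] /IH{}IH /IH <-.
  by case/orP: xz => /eqP/reach1/(tip_reach ag).
by apply: (connect_trans (up x)); rewrite E1 sym; apply: up.
Qed.

Lemma card_comps E g : acyclic g -> (forall x y, g x = Some y -> x \in E /\ y \in E) ->
  #|comps E g| = #|[set x in E | g x == None]|.
Proof.
move=> ag gE; pose blk a := [set y in E | tip g y == a].
have tE x : x \in E -> tip g x \in E.
  by move=> xE; apply: (reach_closed _ xE (tipP x ag).1) => a b /= _ /gE[].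
have -> : comps E g = blk @: [set x in E | g x == None].
  apply/setP=> D; apply/imsetP/imsetP=> -[x xE ->].
    exists (tip g x); first by rewrite !inE tE// (tipP x ag).2.
    by apply/setP=> y; rewrite !inE connect_edge_in// eq_sym.
  move: xE; rewrite inE => /andP[xE /eqP gx]; exists x => //.
  by apply/setP=> y; rewrite !inE connect_edge_in// (tip_id ag gx) eq_sym.
rewrite card_in_imset// => a b; rewrite !inE => /andP[aE /eqP ga] /andP[bE /eqP gb].
move=> /setP/(_ a); rewrite !inE aE (tip_id ag ga) eqxx => /esym/eqP //.
Qed.

End Components.

(** * Supporting lines of convex sequences *)

Section Convex.
Variables (R : realFieldType) (p : nat -> R) (N : nat).
Local Open Scope ring_scope.
Hypothesis p_convex : forall k, (0 < k)%N -> (k.+1 < N)%N ->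
  p k.+1 + p k.+1 <= p k + p k.+2.

Lemma convex_slopes i t : (0 < i)%N -> (i + t < N)%N ->
  p (i + t)%N - p (i + t).+1 <= p i - p i.+1.
Proof.
move=> i0; elim: t => [|t IH]; first by rewrite addn0.
rewrite addnS => lt; have := p_convex (ltn_addr t i0) lt; have := IH (ltnW lt); lra.
Qed.

(** The line through the points at [k] and [k.+1] supports the sequence: to the right of [k] each
    drop is at most [l], to the left at least [l]. *)
Lemma convex_above_line k j : (0 < k < N)%N -> (0 < j <= N)%N ->
  p k + (p k - p k.+1) *+ k <= p j + (p k - p k.+1) *+ j.
Proof.
move=> /andP[k0 kN] /andP[j0 jN]; set l := p k - p k.+1.
have [kj|/ltnW jk] := leqP k j.
  move: jN; rewrite -(subnKC kj); elim: (j - k)%N => [|t IH] le; first by rewrite addn0.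
  rewrite addnS in le *; apply: le_trans (IH (ltnW le)) _; rewrite mulrS.
  have := convex_slopes k0 le; rewrite -/l; move: (l *+ _) => m; lra.
have : (k - j < k)%N by rewrite ltn_subrL j0.
rewrite -[in X in _ -> X](subKn jk); elim: (k - j)%N => [|t IH] lt; first by rewrite subn0.
apply: le_trans (IH (ltnW lt)) _; rewrite -subnSK ?(ltnW lt)//; set i := (k - t.+1)%N.
have ik : (i + t.+1 = k)%N by rewrite subnK// ltnW.
have i0 : (0 < i)%N by rewrite subn_gt0.
have := @convex_slopes i t.+1 i0; rewrite ik -/l => /(_ kN).
rewrite mulrS; move: (l *+ i) => m; lra.
Qed.
End Convex.

(** * Minimum weight forests *)

Section MinimumForests.
Variables (T : finType) (R : realType) (arc : rel T) (w : T -> T -> R).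
Implicit Types (F G : {ffun T -> option T}) (E : {set T}) (x y : T).

Definition arc_ok x (o : option T) := if o is Some y then arc x y else true.

Lemma kforestP k F :
  kforest arc k F <-> admissible arc_ok F /\ #|rootset F| = k.
Proof.
have rT : [set x in [set: T] | F x == None] = rootset F by apply/setP=> x; rewrite !inE.
have FT x y : F x = Some y -> x \in [set: T] /\ y \in [set: T] by rewrite !inE.
split=> [[[FE /no_cycle_acyclic aF] <-]|[/andP[aF /forallP okF] <-]].
  rewrite card_comps ?rT// /admissible aF; split=> //; apply/forallP=> x.
  by rewrite /arc_ok; case Fx: (F x) => [y|//]; case: (FE _ _ Fx).
split; last by rewrite card_comps ?rT.
split; last exact/no_cycle_acyclic.
by move=> x y Fx; rewrite !inE; split=> //; have := okF x; rewrite Fx.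
Qed.

Lemma phi_le k F : kforest arc k F -> (phi arc w k <= fweight w F)%R.
Proof.
move=> kF; rewrite /phi; case: pickP => [F0 _|/(_ F)/asboolP//].
by apply: bigmin_le_cond; apply/asboolP.
Qed.

Lemma optimal_exists k : (exists F, kforest arc k F) -> exists F, optimal arc w k F.
Proof.
case=> F1 kF1; rewrite /optimal /phi; case: pickP => [F0 kF0|/(_ F1)/asboolP//].
apply: (big_ind (fun z => exists F, kforest arc k F /\ fweight w F = z)).
- by exists F0; split=> //; apply/asboolP.
- by move=> a b Ha Hb; rewrite minEle; case: ifP.
- by move=> F /asboolP kF; exists F.
Qed.

Lemma kforest_exists k : (exists F, kforest arc 1 F) -> 0 < k <= #|T| ->
  exists F, kforest arc k F.
Proof.
move=> ex1; elim: k => // -[_ _ //|k IH /= lt].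
have [F /kforestP[adF rF]] := IH (ltnW lt).
have [v vF] : exists v, v \notin rootset F.
  apply/existsP; rewrite -negb_forall; apply/negP=> /forallP H.
  move: lt; rewrite -rF (_ : rootset F = setT) ?cardsT ?ltnn//.
  by apply/setP=> v; rewrite H inE.
exists (upd F v None); apply/kforestP; split; first exact: admissible_upd.
by rewrite rootset_upd_None cardsU1 vF rF.
Qed.

Lemma fweightD F G (P : pred T) :
  (fweight w [ffun x => if P x then G x else F x] +
   fweight w [ffun x => if P x then F x else G x] = fweight w F + fweight w G)%R.
Proof.
rewrite /fweight -!big_split; apply: eq_bigr => x _; rewrite !ffunE /=.
by case: (P x) => //; rewrite addrC.
Qed.

Lemma admissible_mix F G (P : pred T) : admissible arc_ok F -> admissible arc_ok G ->
  (forall x y, P x -> G x = Some y -> P y) ->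
  admissible arc_ok [ffun x => if P x then G x else F x].
Proof.
case/andP=> aF /forallP oF /andP[aG /forallP oG] cl.
rewrite /admissible acyclic_mix//=; apply/forallP=> x; rewrite ffunE.
by case: (P x).
Qed.

(** Exchange argument: of the [k.+2] trees of [G], one contains none of the [k] roots of [F].
    Swapping the arcs of [F] and [G] on its vertex set [D] gives two forests with [k.+1] trees and
    the same total weight; no cycle arises, as [G] has no arc between [D] and its complement. *)
Lemma phi_convex k : (exists F, kforest arc 1 F) -> 0 < k -> k.+1 < #|T| ->
  (phi arc w k.+1 + phi arc w k.+1 <= phi arc w k + phi arc w k.+2)%R.
Proof.
move=> ex1 k0 kT.
have [F [/kforestP[adF rF] <-]] : exists F, optimal arc w k F.
  by apply: optimal_exists; apply: kforest_exists; rewrite // k0 ltnW// ltnW.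
have [G [/kforestP[adG rG] <-]] : exists F, optimal arc w k.+2 F.
  by apply: optimal_exists; apply: kforest_exists.
have aG : acyclic G by case/andP: adG.
have [a aG' aN] : exists2 a, a \in rootset G & a \notin tip G @: rootset F.
  apply/subsetPn; apply/negP=> /subset_leq_card; apply/negP; rewrite -ltnNge.
  by apply: (leq_ltn_trans (leq_imset_card _ _)); rewrite rF rG ltnW.
pose D x := tip G x == a.
have tG x y : G x = Some y -> tip G x = tip G y by move=> /reach1/(tip_reach aG).
have Da : D a by move: aG'; rewrite inE => /eqP Ga; rewrite /D tip_id.
have DF x : D x -> F x != None.
  by move=> Dx; apply: contra aN => Fx; apply/imsetP; exists x; rewrite ?inE// (eqP Dx).
have DG x : D x -> G x = None -> x = a by move=> /eqP <- Gx; rewrite tip_id.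
pose F' := [ffun x => if D x then G x else F x].
pose G' := [ffun x => if D x then F x else G x].
have kF' : kforest arc k.+1 F'.
  apply/kforestP; split.
    by apply: admissible_mix => // x y Dx /tG E; rewrite /D -E.
  have -> : rootset F' = a |: rootset F.
    apply/setP=> x; rewrite !inE ffunE; case: ifP => Dx.
      rewrite (negPf (DF x Dx)) orbF; apply/eqP/eqP=> [/(DG _ Dx)//|->].
      by apply/eqP; rewrite inE in aG'.
    by case: (eqVneq x a) => // xa; rewrite xa Da in Dx.
  by rewrite cardsU1 rF inE DF.
have kG' : kforest arc k.+1 G'.
  have GE : G' = [ffun x => if ~~ D x then G x else F x].
    by apply/ffunP=> x; rewrite !ffunE; case: (D x).
  apply/kforestP; split.
    by rewrite GE; apply: admissible_mix => // x y Dx /tG E; rewrite /D -E.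
  have -> : rootset G' = rootset G :\ a.
    apply/setP=> x; rewrite !inE ffunE; case: ifP => Dx.
      rewrite (negPf (DF x Dx)); apply/esym/negP=> /andP[xa /eqP /(DG _ Dx) E].
      by rewrite E eqxx in xa.
    by case: (eqVneq x a) => // xa; rewrite xa Da in Dx.
  by have := cardsD1 a (rootset G); rewrite aG' rG => -[].
by rewrite -(fweightD F G D); apply: lerD; apply: phi_le.
Qed.

(** * Atoms as classes of inseparable vertices *)

Definition sim k x y := forall F, optimal arc w k F -> tip F x = tip F y.

Lemma optimal_acyclic k F : optimal arc w k F -> acyclic F.
Proof. by case=> /kforestP[/andP[]]. Qed.

Lemma connect_edge_setT F x y : acyclic F ->
  connect (edge_in [set: T] F) x y = (tip F x == tip F y).
Proof. by move=> aF; rewrite connect_edge_in// => a b _; rewrite !inE. Qed.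

(** The part of [E] in the tree of [x] belongs to the algebra and is nonempty, so it is all of
    [E]. *)
Lemma atom_sim k E x y : atom (alg arc w k) E -> x \in E -> y \in E -> sim k x y.
Proof.
move=> [EA _ Emin] xE yE F oF; have aF := optimal_acyclic oF.
pose D := [set z in [set: T] | connect (edge_in [set: T] F) x z].
have DE : E :&: D \in alg arc w k.
  apply/bigcapP=> A /andP[/and3P[A0 /forallP AC /forallP AU] gA].
  have EA' : E \in A.
    by move/bigcapP: EA; apply; rewrite gA andbT; apply/and3P; split=> //; apply/forallP.
  have DA : D \in A.
    apply: (subsetP gA); rewrite inE; apply/asboolP; exists F; split=> //.
    by apply/imsetP; exists x; rewrite ?inE.
  have C S : S \in A -> ~: S \in A by move=> SA; move/implyP: (AC S); apply.
  have U S S' : S \in A -> S' \in A -> S :|: S' \in A.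
    by move=> SA S'A; move/implyP: (AU S) => /(_ SA)/forallP/(_ S')/implyP; apply.
  by rewrite -[E :&: D]setCK setCI C// U// C.
case: (Emin _ DE (subsetIl _ _)) => [/setP/(_ x)|/setP/(_ y)].
  by rewrite !inE xE connect0.
by rewrite !inE yE connect_edge_setT// => /eqP.
Qed.

(** The sets saturated under [sim] form an algebra that contains all generators. *)
Lemma atom_closed k E x y : atom (alg arc w k) E -> x \in E -> sim k x y -> y \in E.
Proof.
move=> [/bigcapP EA _ _] xE xy.
pose A := [set S : {set T} | `[< forall x y, x \in S -> sim k x y -> y \in S >]].
suff : E \in A by rewrite inE => /asboolP/(_ _ _ xE xy).
apply: EA; apply/andP; split; last first.
  apply/subsetP=> S; rewrite inE => /asboolP[F [oF /imsetP[z _ ->]]].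
  rewrite inE; apply/asboolP=> a b; rewrite !inE !connect_edge_setT ?(optimal_acyclic oF)//.
  by move=> + /(_ _ oF) <-.
apply/and3P; split.
- by rewrite inE; apply/asboolP=> a b; rewrite inE.
- apply/forallP=> S; apply/implyP; rewrite !inE => /asboolP H; apply/asboolP=> a b.
  rewrite !inE => aS ab; apply: contra aS => bS; apply: (H b) => // F oF.
  by rewrite (ab F oF).
- apply/forallP=> S; apply/implyP; rewrite inE => /asboolP H.
  apply/forallP=> S'; apply/implyP; rewrite !inE => /asboolP H'; apply/asboolP=> a b.
  by rewrite !inE => /orP[aS|aS'] ab; apply/orP; [left; apply: (H a) | right; apply: (H' a)].
Qed.

Definition leaves F E x := if F x is Some y then y \notin E else true.

(** Each root of the restriction is a vertex where [F] leaves [E] or ends; if there is only one such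
    vertex, there is only one tree. *)
Lemma restr_tree k F E : optimal arc w k F -> E != set0 ->
  (forall x y, x \in E -> y \in E -> leaves F E x -> leaves F E y -> x = y) ->
  is_tree_on arc E (restr F E).
Proof.
move=> oF En uniq; have aF := optimal_acyclic oF.
have rE x y : restr F E x = Some y -> [/\ x \in E, y \in E & F x = Some y].
  rewrite ffunE; case: ifP => // xE; case: (F x) => // z.
  by case: ifP => // zE [<-].
have ar : acyclic (restr F E).
  by apply: (@acyclic_rank _ _ (rk F)) => x y /rE[_ _]; apply: rk_lt.
have rE2 x y : restr F E x = Some y -> x \in E /\ y \in E by move=> /rE[].
split.
  split; last exact/no_cycle_acyclic.
  move=> x y /rE[xE yE Fx]; split=> //.
  by case: oF => /kforestP[/andP[_ /forallP/(_ x)]]; rewrite Fx.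
rewrite card_comps//.
have rootP x : x \in E -> restr F E x = None -> leaves F E x.
  by move=> xE; rewrite ffunE xE /leaves; case: (F x) => // y; case: ifP.
have [x xE] := set0Pn _ En.
have tE : tip (restr F E) x \in E.
  by apply: (reach_closed _ xE (tipP x ar).1) => a b /= _ /rE2[].
apply/eqP/cards1P; exists (tip (restr F E) x); apply/setP=> y; rewrite !inE.
apply/andP/eqP=> [[yE /eqP ry]|->]; last by rewrite tE (tipP x ar).2.
by apply: uniq => //; apply: rootP => //; exact: (tipP x ar).2.
Qed.

(** In a single tree all vertices are inseparable, so [F] can leave an atom only at its unique
    root. *)
Lemma H1 : H arc w 1.
Proof.
move=> F oF E atE; apply: (restr_tree oF); first by case: atE.
have all_sim x y : sim 1 x y.
  move=> G oG; have aG := optimal_acyclic oG.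
  case: oG => /kforestP[_ /eqP/cards1P[a ra]] _.
  have := tip_root x aG; have := tip_root y aG.
  by rewrite ra !inE => /eqP -> /eqP ->.
move=> x y xE yE lx ly; have aF := optimal_acyclic oF.
have root z : leaves F E z -> F z = None.
  rewrite /leaves; case: (F z) => // t /negP[]; exact: (atom_closed atE xE (all_sim x t)).
by rewrite -(tip_id aF (root _ lx)) -(tip_id aF (root _ ly)); apply: all_sim.
Qed.

Section Lagrangian.
Variable k : nat.
Hypotheses (ex1 : exists F, kforest arc 1 F) (k_bounds : 0 < k < #|T|).

(* With the price [lam] for a root, the minimal weights of forests with k and
   k+1 trees are both global minima, by convexity of [phi]. *)
Let lam : R := (phi arc w k - phi arc w k.+1)%R.
Let c x (o : option T) : R := if o is Some y then w x y else lam.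

Lemma cost_lagrangian F : cost c F = (fweight w F + lam *+ #|rootset F|)%R.
Proof.
have -> : #|rootset F| = #|[pred x | F x == None]| by apply: eq_card => x; rewrite !inE.
rewrite -sumr_const [X in (_ + X)%R]big_mkcond /= /cost /fweight -big_split /=.
by apply: eq_bigr => x _; rewrite /c ?inE; case: (F x) => [y|] /=; rewrite ?addr0 ?add0r.
Qed.

Lemma optimal_opt j F : (j == k) || (j == k.+1) ->
  optimal arc w j F <-> F \in opt arc_ok c /\ #|rootset F| = j.
Proof.
move=> jk; have lineE : (phi arc w k + lam *+ k = phi arc w j + lam *+ j)%R.
  case/orP: jk => /eqP-> //; rewrite mulrS /lam; move: (_ *+ k)%R => m; lra.
have j_bounds : 0 < j <= #|T|.
  by case/andP: k_bounds => k0 kT; case/orP: jk => /eqP->; rewrite ?k0 ?(ltnW kT).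
have lower G : admissible arc_ok G -> (phi arc w j + lam *+ j <= cost c G)%R.
  move=> adG; have aG : acyclic G by case/andP: adG.
  have kG : kforest arc #|rootset G| G by apply/kforestP.
  rewrite -lineE cost_lagrangian; apply: le_trans (lerD (phi_le kG) (lexx _)).
  apply: (@convex_above_line _ (phi arc w) #|T|) => //.
    by move=> i i0 iT; apply: phi_convex.
  rewrite max_card andbT; apply/card_gt0P.
  have /card_gt0P[x _] : 0 < #|T| by case/andP: j_bounds; apply: leq_trans.
  by exists (tip G x); apply: tip_root.
split=> [[/kforestP[adF rF] wF]|[/optP[adF Fmin] rF]].
  split=> //; apply/optP; split=> // G /lower.
  by rewrite (cost_lagrangian F) rF wF.
split; first exact/kforestP.
have [F1 oF1] := optimal_exists (kforest_exists ex1 j_bounds).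
have [/kforestP[adF1 rF1] wF1] := oF1.
apply/eqP; rewrite eq_le phi_le ?andbT; last exact/kforestP.
by have := Fmin _ adF1; rewrite !cost_lagrangian rF rF1 wF1 lerD2r.
Qed.

Lemma H_succ : H arc w k.+1.
Proof.
move=> F oF E atE; apply: (restr_tree oF); first by case: atE.
have opS G : optimal arc w k.+1 G <-> G \in opt arc_ok c /\ #|rootset G| = k.+1.
  by apply: optimal_opt; rewrite eqxx orbT.
have [Fo rF] := (opS F).1 oF.
have [P oP] : exists P, optimal arc w k P.
  apply: optimal_exists; apply: kforest_exists => //.
  by case/andP: k_bounds => -> /ltnW.
have [Po rP] : P \in opt arc_ok c /\ #|rootset P| = k.
  by apply/(@optimal_opt k) => //; rewrite eqxx.
have [|Q [cls [tc mixo]]] := @optimal_mixable _ _ arc_ok c.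
  by apply/set0Pn; exists F.
have opt_acyclic G : G \in opt arc_ok c -> acyclic G by move=> /optP[/andP[]].
pose A q o := [exists G in opt arc_ok c, quot cls G q == o].
have admq G : G \in opt arc_ok c -> admissible A (quot cls G).
  move=> Go; have [e ee] := tc _ Go.
  rewrite /admissible (quot_acyclic (opt_acyclic _ Go) ee); apply/forallP=> q.
  by apply/existsP; exists G; rewrite Go eqxx.
(* Any acyclic combination of available quotient arcs is realized by a minimizer, so from here on
   arcs are chosen freely in the quotient. *)
have lift f : admissible A f -> exists2 M, M \in opt arc_ok c & quot cls M = f.
  case/andP=> af /forallP Af.
  have sel q : exists G, G \in opt arc_ok c /\ quot cls G q = f q.
    by have /existsP[G /andP[? /eqP]] := Af q; exists G.
  have [s sP] := choice sel; exists (mix cls s).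
    apply: mixo => [q|]; first by case: (sP q).
    by rewrite (_ : finfun _ = f)//; apply/ffunP=> q; rewrite ffunE; case: (sP q).
  by apply/ffunP=> q; rewrite mix_quot; case: (sP q).
have cls_sim x y : cls x = cls y -> sim k.+1 x y.
  move=> xy G /(opS G)[Go _]; have [e ee] := tc _ Go.
  by apply/eqP; rewrite -(tip_quot_eq (opt_acyclic _ Go) ee) xy.
move=> x y xE yE lx ly; apply: contrapT => /eqP xy.
have [e ee] := tc _ Fo; have aF := opt_acyclic _ Fo.
(* A class lies within one atom, so a vertex at which [F] leaves [E] also leaves its class and is
   therefore its exit. *)
have lexit z : z \in E -> leaves F E z -> z = e (cls z).
  move=> zE; rewrite /leaves => lz; apply/eqP; rewrite -(exitpE ee) /exitp.
  case: (F z) lz => // t tE /=; apply: contra tE => /eqP[/esym/cls_sim].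
  exact: atom_closed.
have sepF f : admissible A f -> #|rootset f| = k.+1 ->
    tip f (cls x) != tip f (cls y) -> False.
  move=> /lift[M Mo <-]; have [e' ee'] := tc _ Mo; have aM := opt_acyclic _ Mo.
  rewrite (card_rootset_quot ee') (tip_quot_eq aM ee') => rM /eqP; apply.
  by apply: (atom_sim atE xE yE); apply/(opS M).
case: (separated_or_dominated (cls x) (cls y) (admq _ Fo)).
  (* The number of trees is brought to [k.+1]: with arcs of [P], which has [k] trees, if [f] has too
     many, and with roots of [F] if it has too few. *)
  case=> f admf sepf; case: (leqP k.+1 #|rootset f|) => [le|/ltnW le].
    have [|f' [? ? ?]] := separated_fewer_roots (admq _ Po) _ admf le sepf.
      by have [e' ee'] := tc _ Po; rewrite (card_rootset_quot ee') rP.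
    exact: (sepF f').
  have [|f' [? ? ?]] := separated_more_roots (admq _ Fo) _ admf le sepf.
    by rewrite (card_rootset_quot ee) rF.
  exact: (sepF f').
case=> r [Z [xZ yZ Zdom]].
(* A path starting in [Z] can neither end nor leave [Z] before it meets [r], so all of [Z] shares
   the tip of [r]. *)
have Z_tip G z : optimal arc w k.+1 G -> cls z \in Z ->
    tip (quot cls G) (cls z) = tip (quot cls G) r.
  move=> /(opS G)[Go _]; move: (cls z); have /andP[aq _] := admq _ Go.
  have AG q : A q (quot cls G q) by apply/existsP; exists G; rewrite Go eqxx.
  apply: (acyclic_ind aq) => [q qr qZ|q q' qq' IH qZ]; have [->//|nr] := eqVneq q r.
    by have [] := Zdom _ _ qZ nr (AG q); rewrite qr.
  have [u uZ] := Zdom _ _ qZ nr (AG q); rewrite qq' => -[E1]; subst u.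
  by rewrite -IH//; apply: tip_reach => //; apply: reach1.
(* If the class of [z] were not [r], the head of the arc at [z] would again have its class in [Z].
   It would then be inseparable from [z] and lie in [E]. *)
have noleave z : z \in E -> leaves F E z -> cls z \in Z -> cls z = r.
  move=> zE lz zZ; apply: contrapT => /eqP nr.
  have [|u uZ] := Zdom (cls z) (quot cls F (cls z)) zZ nr.
    by apply/existsP; exists F; rewrite Fo eqxx.
  rewrite (quotE ee) -(lexit z zE lz); move: lz; rewrite /leaves.
  case: (F z) => // t tE [tu]; case/negP: tE; apply: (atom_closed atE zE) => G oG.
  have [Go _] := (opS G).1 oG; have [e' ee'] := tc _ Go.
  apply/eqP; rewrite -(tip_quot_eq (opt_acyclic _ Go) ee').
  by rewrite (Z_tip G z oG zZ) (Z_tip G t oG) ?tu.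
case/eqP: xy; rewrite (lexit x xE lx) (lexit y yE ly).
by rewrite (noleave x xE lx xZ) (noleave y yE ly yZ).
Qed.

End Lagrangian.

End MinimumForests.

Local Open Scope ring_scope.

Theorem theorem1 (T : finType) (R : realType) (arc : rel T) (w : T -> T -> R) :
  (exists F, kforest arc 1 F) ->
  (forall k : nat, (1 <= k <= #|T| - 1)%N -> strict_gap arc w k -> H arc w k) ->
  forall k : nat, (1 <= k <= #|T|)%N -> H arc w k.
Proof.
move=> ex1 _ [//|[_|k /andP[_ kT]]]; first exact: H1.
exact: H_succ.
Qed.
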